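(* Let $\mathbb{F}$ be an infinite field. For every $n \le 5$, the unitriangular group $UT_n(\mathbb{F})$ has finitely many automorphism orbits, i.e. $\omega(UT_n(\mathbb{F}))<\infty$. In particular, $\omega(UT_3(\mathbb{F}))=3$. Furthermore, the number of orbits of $UT_4(\mathbb{F})$ under the conjugation action of $T_4(\mathbb{F})$ is $16$, and the number of orbits of $UT_5(\mathbb{F})$ under the conjugation action of $T_5(\mathbb{F})$ is $61$.
   Context: For a group $G$, the automorphism orbits of $G$ are the orbits of the natural action of $\mathrm{Aut}(G)$ on the set $G$ (two elements $g,h$ lie in the same orbit iff $g^\alpha=h$ for some $\alpha\in\mathrm{Aut}(G)$); their number is denoted $\omega(G)$ (the orbit of the identity is counted). For a field $\mathbb{F}$, $UT_n(\mathbb{F})$ is the group (under multiplication) of $n\times n$ upper triangular matrices over $\mathbb{F}$ with all diagonal entries equal to $1$. $T_n(\mathbb{F})$ is the group of invertible upper triangular $n\times n$ matrices over $\mathbb{F}$; it normalizes $UT_n(\mathbb{F})$ in $GL_n(\mathbb{F})$ and acts on it by conjugation, $x^A=A^{-1}xA$.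
   Formalization: The claim that UT_3(F) has exactly 3 automorphism orbits is stated only for fields of characteristic not 2; in characteristic 2 it fails, since the identity, I+E13, I+E12 and I+E12+E23 (order 4) lie in four distinct orbits. *)

(* Defs.v *)
From HB Require Import structures.
From mathcomp Require Import all_boot all_order all_algebra.
From mathcomp Require Import boolp classical_sets functions cardinality.

Set Implicit Arguments.
Unset Strict Implicit.
Unset Printing Implicit Defensive.

Import GRing.Theory.
Local Open Scope ring_scope.
Local Open Scope classical_set_scope.

(* On and below the diagonal (j <= i), A has the entries of the identity; this
   covers both the unit diagonal and the vanishing lower part. *)
Definition unitriangular (F : fieldType) (n : nat) (A : 'M[F]_n) : bool :=
  [forall i : 'I_n, forall j : 'I_n, (j <= i)%N ==> (A i j == (i == j)%:R)].

Definition invertible_triangular (F : fieldType) (n : nat) (A : 'M[F]_n) : bool :=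
  [forall i : 'I_n, forall j : 'I_n, (j < i)%N ==> (A i j == 0)]
  && (A \in unitmx).

Record UT (n : nat) (F : fieldType) : Type :=
  MkUT { UT_val :> 'M[F]_n; UT_valP : unitriangular UT_val }.

HB.instance Definition _ n F := [isSub of UT n F for @UT_val n F].
HB.instance Definition _ n F := [Choice of UT n F by <:].

Section UnitriangularGroup.
Variables (n : nat) (F : fieldType).
Implicit Types (A B : 'M[F]_n) (x y z : UT n F).

Lemma unitriangularP A :
  reflect (forall i j : 'I_n, (j <= i)%N -> A i j = (i == j)%:R)
          (unitriangular A).
Proof.
apply: (iffP forallP) => [H i j ji | H i].
  by have /forallP/(_ j)/implyP/(_ ji)/eqP := H i.
by apply/forallP => j; apply/implyP => ji; rewrite H.
Qed.

Lemma unitriangular1 : unitriangular (1%:M : 'M[F]_n).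
Proof. by apply/unitriangularP => i j _; rewrite mxE. Qed.

Lemma unitriangularM A B :
  unitriangular A -> unitriangular B -> unitriangular (A *m B).
Proof.
move=> /unitriangularP hA /unitriangularP hB; apply/unitriangularP => i j ji.
rewrite mxE (bigD1 i) //= big1 ?addr0 => [|k ki].
  by rewrite hA // eqxx mul1r hB.
have [lki | lik] := leqP k i; first by rewrite hA // eq_sym (negPf ki) mul0r.
rewrite hB; last exact: leq_trans ji (ltnW lik).
by rewrite -val_eqE gtn_eqF ?mulr0 //= (leq_ltn_trans ji lik).
Qed.

Lemma unitriangular_unitmx A : unitriangular A -> A \in unitmx.
Proof.
move=> /unitriangularP hA; rewrite -unitmx_tr unitmxE det_trig.
  by rewrite big1 ?unitr1 // => i _; rewrite mxE hA // eqxx.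
apply/is_trig_mxP => i j ij; rewrite mxE hA ?(ltnW ij) //.
by rewrite -val_eqE gtn_eqF.
Qed.

Lemma unitriangularV A : unitriangular A -> unitriangular (invmx A).
Proof.
move=> uA; have Au := unitriangular_unitmx uA.
move/unitriangularP: uA => hA; apply/unitriangularP => i j.
have [m] := ubnP (j : nat); elim: m j => // m IHm j /ltnSE jm ji.
have := congr1 (fun M : 'M[F]_n => M i j) (mulVmx Au); rewrite !mxE.
rewrite (bigD1 j) //= big1 ?addr0 => [|k kj]; first by rewrite hA // eqxx mulr1.
have [ljk | lkj] := leqP j k; first by rewrite hA // (negPf kj) mulr0.
rewrite IHm ?(leq_trans lkj) //; last exact: leq_trans (ltnW lkj) ji.
by rewrite -val_eqE gtn_eqF ?mul0r //= (leq_trans lkj ji).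
Qed.

Definition UT_one : UT n F := MkUT unitriangular1.
Definition UT_mul x y : UT n F := MkUT (unitriangularM (UT_valP x) (UT_valP y)).
Definition UT_inv x : UT n F := MkUT (unitriangularV (UT_valP x)).

Lemma UT_mulA : associative UT_mul.
Proof. by move=> x y z; apply: val_inj; rewrite /= mulmxA. Qed.

Lemma UT_mul1 : left_id UT_one UT_mul.
Proof. by move=> x; apply: val_inj; rewrite /= mul1mx. Qed.

Lemma UT_mulr1 : right_id UT_one UT_mul.
Proof. by move=> x; apply: val_inj; rewrite /= mulmx1. Qed.

Lemma UT_mulV : left_inverse UT_one UT_inv UT_mul.
Proof.
by move=> x; apply: val_inj; rewrite /= mulVmx ?unitriangular_unitmx ?UT_valP.
Qed.

Lemma UT_mulrV : right_inverse UT_one UT_inv UT_mul.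
Proof.
by move=> x; apply: val_inj; rewrite /= mulmxV ?unitriangular_unitmx ?UT_valP.
Qed.

HB.instance Definition _ := isGroup.Build (UT n F)
  UT_mulA UT_mul1 UT_mulr1 UT_mulV UT_mulrV.

End UnitriangularGroup.

Definition aut_orbit (G : groupType) (g : G) : set G :=
  [set h | exists2 f : {multiplicative G -> G}, bijective f & f g = h].

Definition aut_orbits (G : groupType) : set (set G) := range (@aut_orbit G).

Arguments aut_orbits G : clear implicits.

Definition T_orbit (n : nat) (F : fieldType) (x : UT n F) : set (UT n F) :=
  [set y | exists2 A : 'M[F]_n,
     invertible_triangular A & UT_val y = invmx A *m UT_val x *m A].

Definition T_orbits (n : nat) (F : fieldType) : set (set (UT n F)) :=
  range (@T_orbit n F).

Arguments T_orbits n F : clear implicits.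

(* Main.v *)
From HB Require Import structures.
Require Import Defs.
From mathcomp Require Import all_boot all_order all_algebra.
From mathcomp Require Import boolp classical_sets functions cardinality.
From mathcomp Require Import ring.

(* Conjugating x by A amounts to conjugating the strictly upper triangular
   matrix N = x - 1, so the T_n-orbits are counted on such matrices. They are
   reduced symbolically: of each entry one only remembers whether it is 0, 1,
   nonzero or arbitrary. An arbitrary entry is cleared by conjugating with
   transvections 1 + c E_kl when at most two of them do so without spoiling the
   entries already treated, and otherwise one distinguishes whether it vanishes;
   at the end diagonal conjugation turns the nonzero entries into ones. For
   n <= 5 this ends in 0/1 matrices, 16 of them for n = 4 and 61 for n = 5.
   Two distinct such matrices r and s are never conjugate: in the linear system
   r A = A s, repeatedly discarding the unknowns already known to vanish leaves
   equations with a single unknown, which eventually force a diagonal entry of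
   A to be 0.

   Conjugation by T_n induces automorphisms of UT_n, whence finiteness of the
   number of automorphism orbits. The three orbits of UT_3 outside
   characteristic 2 consist of the identity, of the other central elements, and
   of the noncentral elements. *)

Set Implicit Arguments.
Unset Strict Implicit.
Unset Printing Implicit Defensive.

Import GRing.Theory.
Local Open Scope ring_scope.

(** * Conjugation by triangular matrices *)

Section TriangularConjugacy.
Variables (F : fieldType) (n : nat).
Implicit Types (A B N : 'M[F]_n).

Lemma invertible_triangularP A :
  reflect ((forall i j : 'I_n, (j < i)%N -> A i j = 0) /\
           (forall i, A i i != 0))
          (invertible_triangular A).
Proof.
have unit_diag : (forall i j : 'I_n, (j < i)%N -> A i j = 0) ->
    (A \in unitmx) = [forall i, A i i != 0].
  move=> A0; rewrite -unitmx_tr unitmxE det_trig; last first.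
    by apply/is_trig_mxP => i j ij; rewrite mxE A0.
  rewrite unitfE (eq_bigr (fun i => A i i)) => [|i _]; last by rewrite mxE.
  by apply/prodf_neq0/forallP => H i //; apply: H.
apply: (iffP andP) => [[/forallP A0 uA] | [A0 dA]].
  have {}A0 (i j : 'I_n) : (j < i)%N -> A i j = 0.
    by move=> ji; have /forallP/(_ j)/implyP/(_ ji)/eqP := A0 i.
  by split=> //; apply/forallP; rewrite -unit_diag.
split; last by rewrite unit_diag //; apply/forallP.
by apply/forallP => i; apply/forallP => j; apply/implyP => ji; rewrite A0.
Qed.

Lemma invertible_triangular1 : invertible_triangular (1%:M : 'M[F]_n).
Proof.
apply/invertible_triangularP; split=> [i j ji|i]; rewrite mxE.
  by rewrite -val_eqE gtn_eqF.
by rewrite eqxx oner_neq0.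
Qed.

Lemma invertible_triangularM A B :
  invertible_triangular A -> invertible_triangular B ->
  invertible_triangular (A *m B).
Proof.
move=> /andP[/forallP A0 uA] /andP[/forallP B0 uB].
apply/andP; split; last by rewrite unitmx_mul uA.
apply/forallP => i; apply/forallP => j; apply/implyP => ji.
rewrite mxE big1 // => k _; have [ki | ik] := ltnP k i.
  by have /forallP/(_ k)/implyP/(_ ki)/eqP-> := A0 i; rewrite mul0r.
have /forallP/(_ j)/implyP/(_ (leq_trans ji ik))/eqP-> := B0 k.
by rewrite mulr0.
Qed.

(** Induction on the column [j]: in entry [(i, j)] of [invmx A *m A], the terms with [k < j] vanish
    by induction and those with [k > j] by triangularity of [A]. What remains is
    [invmx A i j * A j j = 0], and [A j j] is nonzero. *)
Lemma invertible_triangularV A :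
  invertible_triangular A -> invertible_triangular (invmx A).
Proof.
move=> tA; have /andP[_ uA] := tA.
have [A0 dA] := invertible_triangularP _ tA.
apply/andP; split; last by rewrite unitmx_inv.
apply/forallP => i; apply/forallP => j; apply/implyP => ji; apply/eqP.
have [m] := ubnP (j : nat); elim: m j ji => // m IHm j ji /ltnSE jm.
have := congr1 (fun M : 'M[F]_n => M i j) (mulVmx uA); rewrite !mxE.
rewrite (bigD1 j) //= big1 ?addr0 => [|k kj].
  rewrite -val_eqE gtn_eqF // => /eqP; rewrite mulf_eq0 (negPf (dA j)) orbF.
  by move/eqP.
have [kltj | jk] := ltnP k j.
  by rewrite IHm ?mul0r ?(ltn_trans kltj ji) ?(leq_trans kltj jm).
by rewrite A0 ?mulr0 // ltn_neqAle jk andbT eq_sym.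
Qed.

(** Written without an inverse, the relation is linear in [A]; the separation of representatives
    exploits this. *)
Definition tconj N N' :=
  exists2 A, invertible_triangular A & N *m A = A *m N'.

Lemma tconj_refl N : tconj N N.
Proof.
by exists 1%:M; [exact: invertible_triangular1 | rewrite mulmx1 mul1mx].
Qed.

Lemma tconj_sym N N' : tconj N N' -> tconj N' N.
Proof.
case=> A tA NA; exists (invmx A); first exact: invertible_triangularV.
have /andP[_ uA] := tA.
have -> : N' = invmx A *m N *m A by rewrite -mulmxA NA mulmxA mulVmx // mul1mx.
by rewrite -[LHS]mulmxA mulmxV // mulmx1.
Qed.

Lemma tconj_trans N1 N2 N3 : tconj N1 N2 -> tconj N2 N3 -> tconj N1 N3.
Proof.
move=> [A tA NA] [B tB NB]; exists (A *m B); first exact: invertible_triangularM.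
by rewrite mulmxA NA -mulmxA NB mulmxA.
Qed.

(** The conjugator is 1 + c E_kl. The hypothesis [N l k = 0] kills the quadratic term c^2 E_kl N
    E_kl, so every entry of the conjugate is affine in [c]. *)
Lemma tconj_shear N (k l : 'I_n) c : (k < l)%N -> N l k = 0 ->
  tconj N (\matrix_(i, j)
    (N i j + c * N i k * (j == l)%:R - c * N l j * (i == k)%:R)).
Proof.
move=> kl Nlk; exists (\matrix_(i, j) ((i == j)%:R + c * ((i == k) && (j == l))%:R)).
  have lk : (l == k) = false by rewrite -val_eqE gtn_eqF.
  apply/invertible_triangularP; split=> [i j ji|i]; rewrite mxE.
    rewrite -val_eqE gtn_eqF // add0r; case: eqP => [ik|_]; last by rewrite mulr0.
    case: eqP => [jl|_]; last by rewrite mulr0.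
    by move: ji; rewrite ik jl ltnNge (ltnW kl).
  by rewrite eqxx; case: (i =P k) => [->|_];
    rewrite 1?[k == l]eq_sym ?lk mulr0 addr0 oner_neq0.
apply/matrixP => i j; rewrite !mxE.
under eq_bigr => a _ do rewrite mxE mulrDr.
rewrite big_split /= (bigD1 j) //= big1 => [|a aj]; last by rewrite (negPf aj) mulr0.
rewrite (bigD1 k) //= big1 => [|a ak]; last by rewrite (negPf ak) !mulr0.
under [RHS]eq_bigr => a _ do rewrite !mxE mulrDl.
rewrite big_split /= (bigD1 i) //= big1 => [|a ai]; last first.
  by rewrite eq_sym (negPf ai) mul0r.
rewrite [X in _ = _ + X](bigD1 l) //= [in RHS]big1 => [|a al]; last first.
  by rewrite (negPf al) andbF mulr0 mul0r.
have lk : (l == k) = false by rewrite -val_eqE gtn_eqF.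
rewrite !eqxx Nlk lk /= !andbT !mulr0 !mul0r !addr0 subr0 mulr1 mul1r.
by ring.
Qed.

Lemma tconj_scale N (d : 'rV[F]_n) : (forall i, d 0 i != 0) ->
  tconj N (\matrix_(i, j) ((d 0 i)^-1 * N i j * d 0 j)).
Proof.
move=> d0; exists (diag_mx d).
  apply/invertible_triangularP; split=> [i j ji|i]; rewrite mxE.
    by rewrite -val_eqE gtn_eqF.
  by rewrite eqxx d0.
apply/matrixP => i j; rewrite mul_mx_diag mul_diag_mx !mxE.
by rewrite !mulrA mulfV // mul1r.
Qed.

Lemma T_orbitP (x y : UT n F) :
  T_orbit x y <-> tconj (UT_val x - 1%:M) (UT_val y - 1%:M).
Proof.
split=> [[A tA yA] | [A tA xA]]; exists A => //; have /andP[_ uA] := tA.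
  by rewrite yA mulmxBl mulmxBr mul1mx mulmx1 mulmxA mulmxA mulmxV // mul1mx.
have {}xA : UT_val x *m A = A *m UT_val y.
  by apply/eqP; rewrite -subr_eq0 -(subrK A (_ *m A)) -{2}[A]mul1mx -mulmxBl xA
    mulmxBr mulmx1 subrK subrr.
by rewrite -mulmxA xA mulmxA mulVmx // mul1mx.
Qed.

Lemma eq_T_orbit (x y : UT n F) :
  T_orbit x = T_orbit y <-> tconj (UT_val x - 1%:M) (UT_val y - 1%:M).
Proof.
split=> [xy | xy]; first by apply/T_orbitP; rewrite xy; apply/T_orbitP/tconj_refl.
apply/funext => z; apply/propext; rewrite !T_orbitP.
by split; apply: tconj_trans => //; apply: tconj_sym.
Qed.

End TriangularConjugacy.

(** * Symbolic reduction *)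

Definition entry (T : Type) (d : T) (s : seq (seq T)) (p : nat * nat) : T :=
  nth d (nth [::] s p.1) p.2.

Definition tab (T : Type) (n : nat) (f : nat * nat -> T) : seq (seq T) :=
  mkseq (fun i => mkseq (fun j => f (i, j)) n) n.

Lemma entry_tab (T : Type) (d : T) n (f : nat * nat -> T) p :
  (p.1 < n)%N -> (p.2 < n)%N -> entry d (tab n f) p = f p.
Proof. by case: p => i j i_n j_n; rewrite /entry !nth_mkseq. Qed.

(** The order matters: rows from the bottom up, each from left to right, is the order in which
    entries are cleared and normalized. *)
Definition upper (n : nat) : seq (nat * nat) :=
  [seq (i, j) | i <- rev (iota 0 n), j <- iota i.+1 (n - i.+1)].

Lemma mem_upper n p : p \in upper n -> (p.1 < p.2 < n)%N.
Proof.
case/allpairsPdep => i [j [_ + ->]]; rewrite mem_iota /= => /andP[ij].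
rewrite ij /=; case: (leqP i.+1 n) => [/subnKC-> // | /ltnW].
by rewrite -subn_eq0 => /eqP->; rewrite addn0 ltnS leqNgt ij.
Qed.

Inductive cell := Zero | One | Unit | Any.

(** Kept transparent because the boolean equality on cells must compute. *)
Lemma cell_comparable : comparable cell.
Proof. by move=> c d; rewrite /decidable; decide equality. Defined.

HB.instance Definition _ := hasDecEq.Build cell (compareP cell_comparable).

Definition state := seq (seq cell).

Notation cell_at := (entry Zero).

Definition set_cell n (s : state) p c : state :=
  tab n (fun q => if q == p then c else cell_at s q).

(* Effect on the cells of conjugating by 1 + c E_kl, the scalar c being chosen
   so that entry p vanishes. *)
Definition shear n k l p (s : state) : state :=
  tab n (fun q =>
    if q == p then Zero
    else if (q.2 == l) && (cell_at s (q.1, k) != Zero)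
         || (q.1 == k) && (cell_at s (l, q.2) != Zero) then Any
    else cell_at s q).

Definition is_unit (c : cell) := (c == One) || (c == Unit).

(** Conjugation by 1 + c E_kl alters only column [l], by multiples of column [k], and row [k], by
    multiples of row [l]. The two lists clear an entry of that column or of that row by means of a
    nonzero pivot; position [(k, l)], which feels both changes, is never a target. *)
Definition shears n (s : state) k l : seq state :=
  [seq shear n k l (i, l) s |
    i <- iota 0 n & (i != k) && is_unit (cell_at s (i, k))] ++
  [seq shear n k l (k, j) s |
    j <- iota 0 n & (j != l) && is_unit (cell_at s (l, j))].

Definition moves n (s : state) : seq state :=
  [seq t | q <- [seq q <- upper n | cell_at s (q.2, q.1) == Zero],
           t <- shears n s q.1 q.2].

Definition two_moves n s : seq state :=
  moves n s ++ [seq u | t <- moves n s, u <- moves n t].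

Fixpoint leaves n (old new : seq (nat * nat)) (s : state) : seq state :=
  if new is p :: new' then
    let old' := p :: old in
    if cell_at s p == Any then
      if [seq t <- two_moves n s | all (fun q => cell_at t q != Any) old'] is t :: _
      then leaves n old' new' t
      else leaves n old' new' (set_cell n s p Zero) ++
           leaves n old' new' (set_cell n s p Unit)
    else leaves n old' new' s
  else [:: s].

(* Effect on the cells of conjugating by a diagonal matrix with entries c on v
   and 1 off v, the scalar c being chosen so that entry p becomes 1. *)
Definition scale n (v : bitseq) p (s : state) : state :=
  tab n (fun q =>
    if q == p then One
    else if nth false v q.1 == nth false v q.2 then cell_at s q
    else if cell_at s q == One then Unit
    else cell_at s q).

Fixpoint bitseqs n : seq bitseq :=
  if n is n'.+1 then [seq b :: v | b <- [:: true; false], v <- bitseqs n']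
  else [:: [::]].

Definition scalings n p (s : state) : seq state :=
  [seq scale n v p s | v <- bitseqs n & ~~ nth false v p.1 && nth false v p.2].

(** Only a scaling that preserves the ones already present is accepted. If there is none, [s] keeps
    its [Unit], and the later test [normal] fails. *)
Definition normalize_at n (s : state) p : state :=
  if cell_at s p == Unit then
    head s [seq t <- scalings n p s |
            all (fun q => (cell_at s q == One) ==> (cell_at t q == One)) (upper n)]
  else s.

Definition normalize n s := foldl (normalize_at n) s (upper n).

Definition generic n : state :=
  tab n (fun p => if (p.1 < p.2)%N then Any else Zero).

Definition reps n : seq state :=
  [seq normalize n t | t <- leaves n [::] (upper n) (generic n)].

Definition normal n (s : state) : bool :=
  s == tab n (fun p => if (p.1 < p.2)%N && (cell_at s p == One) then One else Zero).

(** * Soundness of the symbolic moves for actual matrices *)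

Section Soundness.
Variables (F : fieldType) (n : nat).
Implicit Types (s t u : state) (N : 'M[F]_n) (c : cell).

Definition cell_sem c (x : F) : bool :=
  match c with
  | Zero => x == 0
  | One => x == 1
  | Unit => x != 0
  | Any => true
  end.

Definition realizes s N :=
  forall i j : 'I_n, cell_sem (cell_at s (val i, val j)) (N i j).

Definition pattern s : 'M[F]_n :=
  \matrix_(i, j) (cell_at s (val i, val j) == One)%:R.

Definition leads_to s (ts : seq state) := forall N, realizes s N ->
  exists t N', [/\ t \in ts, realizes t N' & tconj N N'].

Lemma leads_to_refl s : leads_to s [:: s].
Proof.
by move=> N sN; exists s, N; split=> //; [rewrite mem_head | apply: tconj_refl].
Qed.

Lemma leads_to_sub s ts us :
  {subset ts <= us} -> leads_to s ts -> leads_to s us.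
Proof.
move=> tsus lts N /lts[t [N' [tin tN' NN']]].
by exists t, N'; split=> //; apply: tsus.
Qed.

Lemma leads_to_trans s ts us :
  leads_to s ts -> {in ts, forall t, leads_to t us} -> leads_to s us.
Proof.
move=> lts ltu N /lts[t [N' [tin tN' NN']]].
have [u [N'' [uin uN'' N'N'']]] := ltu t tin N' tN'.
by exists u, N''; split=> //; apply: tconj_trans N'N''.
Qed.

Lemma is_unit_neq0 c x : is_unit c -> cell_sem c x -> x != 0.
Proof. by case: c => //= _ /eqP->; apply: oner_neq0. Qed.

Lemma shear_sound s N (k l : 'I_n) (a : F) p :
  realizes s N -> (k < l)%N -> cell_at s (val l, val k) = Zero ->
  (forall i j : 'I_n, (val i, val j) = p ->
     N i j + a * N i k * (j == l)%:R - a * N l j * (i == k)%:R = 0) ->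
  exists2 N', realizes (shear n k l p s) N' & tconj N N'.
Proof.
move=> sN kl slk tgt.
have Nlk : N l k = 0 by have := sN l k; rewrite slk => /eqP.
eexists; last exact: (tconj_shear a kl Nlk).
move=> i j; rewrite entry_tab //=; case: eqP => [ijp | _].
  by apply/eqP; rewrite mxE tgt.
rewrite mxE -!val_eqE /=.
(* Four cases, according to whether the entry lies in column [l] and in row [k]. In each, an entry
   not marked [Any] receives only corrections whose factor is known to be 0. *)
case: (eqVneq (val j) l) => [/val_inj-> | _];
  case: (eqVneq (val i) k) => [/val_inj-> | _] /=;
  rewrite ?(mulr0, mulr1, subr0, addr0) //.
- case: eqP => //= skk; case: eqP => //= sll.
  have := sN k k; rewrite skk => /eqP->; have := sN l l; rewrite sll => /eqP->.
  by rewrite !mulr0 subr0 addr0; apply: sN.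
- case: eqP => //= sik; have := sN i k; rewrite sik => /eqP->.
  by rewrite mulr0 addr0; apply: sN.
- case: eqP => //= slj; have := sN l j; rewrite slj => /eqP->.
  by rewrite mulr0 subr0; apply: sN.
- exact: sN.
Qed.

Lemma shears_sound s t (k l : 'I_n) : (k < l)%N -> cell_at s (val l, val k) = Zero ->
  t \in shears n s k l -> leads_to s [:: t].
Proof.
move=> kl slk + N sN; rewrite mem_cat => tin.
suff [N' tN' NN'] : exists2 N', realizes t N' & tconj N N'.
  by exists t, N'; rewrite mem_head.
case/orP: tin => /mapP[a]; rewrite mem_filter mem_iota;
  move=> /andP[/andP[ne un] /= a_n] ->.
  have Nak := is_unit_neq0 un (sN (Ordinal a_n) k).
  (* The scalar solves N_il + a N_ik = 0; in the row case below it solves N_kj - a N_lj = 0. *)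
  apply: (shear_sound (a := - N (Ordinal a_n) l / N (Ordinal a_n) k) sN kl slk).
  move=> i j [ia /val_inj ->]; have -> : i = Ordinal a_n by apply: val_inj.
  rewrite eqxx mulr1 -val_eqE (negPf ne) mulr0 subr0.
  by rewrite divfK // addrN.
have Nla := is_unit_neq0 un (sN l (Ordinal a_n)).
apply: (shear_sound (a := N k (Ordinal a_n) / N l (Ordinal a_n)) sN kl slk).
move=> i j [/val_inj -> ja]; have -> : j = Ordinal a_n by apply: val_inj.
rewrite eqxx mulr1 -val_eqE (negPf ne) mulr0 addr0.
by rewrite divfK // addrN.
Qed.

Lemma moves_sound s t : t \in moves n s -> leads_to s [:: t].
Proof.
case/allpairsPdep => [[k l] [u [+ + ->]]].
rewrite mem_filter /= => /andP[/eqP slk /mem_upper/= /andP[kl l_n]].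
exact: (@shears_sound _ _ (Ordinal (ltn_trans kl l_n)) (Ordinal l_n)).
Qed.

Lemma two_moves_sound s t : t \in two_moves n s -> leads_to s [:: t].
Proof.
rewrite mem_cat => /orP[/moves_sound //| /allpairsPdep[u [v [su uv ->]]]].
apply: (leads_to_trans (moves_sound su)) => w; rewrite inE => /eqP->.
exact: moves_sound.
Qed.

Lemma split_sound s p : cell_at s p = Any ->
  leads_to s [:: set_cell n s p Zero; set_cell n s p Unit].
Proof.
move=> sp N sN.
(* As [p] is any pair of naturals, [b] is phrased existentially; it is false when [p] lies outside
   the matrix. *)
pose b := [exists i : 'I_n, exists j : 'I_n, ((val i, val j) == p) && (N i j != 0)].
exists (set_cell n s p (if b then Unit else Zero)), N; split.
- by rewrite !inE; case: b; rewrite eqxx ?orbT.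
- move=> i j; rewrite entry_tab //=; case: eqP => [ijp | _]; last exact: sN.
  have -> : b = (N i j != 0).
    rewrite /b; apply/existsP/idP => [[i' /existsP[j' /andP[]]] | Nij].
      by rewrite -ijp xpair_eqE => /andP[/eqP/val_inj-> /eqP/val_inj->].
    by exists i; apply/existsP; exists j; rewrite ijp eqxx.
  by case: (boolP (N i j == 0)).
- exact: tconj_refl.
Qed.

Lemma leaves_sound new old s : leads_to s (leaves n old new s).
Proof.
elim: new old s => [|p new IH] old s /=; first exact: leads_to_refl.
have [sp|_] := eqVneq (cell_at s p) Any; last exact: IH.
case E: [seq _ <- _ | _] => [|t ts].
  apply: (leads_to_trans (split_sound sp)) => t; rewrite !inE.
  by case/orP=> /eqP->; apply: leads_to_sub (IH (p :: old) _) => u;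
    rewrite mem_cat => ->;
    rewrite ?orbT.
have : t \in t :: ts by rewrite mem_head.
rewrite -E mem_filter => /andP[_ /two_moves_sound st].
by apply: leads_to_trans st _ => u; rewrite inE => /eqP->; apply: IH.
Qed.

Lemma scale_sound s v (k l : 'I_n) :
  is_unit (cell_at s (val k, val l)) -> ~~ nth false v k -> nth false v l ->
  leads_to s [:: scale n v (val k, val l) s].
Proof.
move=> skl vk vl N sN; have Nkl := is_unit_neq0 skl (sN k l).
(* Since [v] contains [l] but not [k], entry [(k, l)] is multiplied by its own inverse. *)
pose d : 'rV[F]_n := \row_i if nth false v i then (N k l)^-1 else 1.
have d0 i : d 0 i != 0.
  by rewrite mxE; case: ifP => _; rewrite ?invr_eq0 ?oner_neq0.
do 2!eexists; split; [exact: mem_head | | exact: (tconj_scale N d0)].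
move=> i j; rewrite entry_tab //=; case: eqP => [[/val_inj-> /val_inj->]|_] /=.
  by rewrite !mxE vl (negPf vk) invr1 mul1r divff.
have [dij|_] := eqVneq (nth false v i) (nth false v j).
  have {}dij : d 0 i = d 0 j by rewrite !mxE dij.
  by rewrite mxE dij mulrAC mulVf // mul1r sN.
rewrite mxE; case: (cell_at s _) (sN i j) => //= [/eqP->|/eqP->|Nij].
- by rewrite mulr0 mul0r.
- by rewrite mulr1 mulf_neq0 ?invr_eq0.
- by rewrite !mulf_neq0 ?invr_eq0.
Qed.

Lemma normalize_at_sound s p : p \in upper n ->
  leads_to s [:: normalize_at n s p].
Proof.
case: p => k l /mem_upper/= /andP[kl l_n]; rewrite /normalize_at.
have k_n := ltn_trans kl l_n.
have [skl|_] := eqVneq (cell_at s (k, l)) Unit; last exact: leads_to_refl.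
case E: [seq _ <- _ | _] => [|t ts] /=; first exact: leads_to_refl.
have : t \in t :: ts by rewrite mem_head.
rewrite -E mem_filter => /andP[_ /mapP[v]]; rewrite mem_filter /=.
case/andP=> /andP[vk vl] _ -> /=.
apply: (@scale_sound s v (Ordinal k_n) (Ordinal l_n)) => //=.
by rewrite skl.
Qed.

Lemma normalize_sound s : leads_to s [:: normalize n s].
Proof.
rewrite /normalize; have : {subset upper n <= upper n} by [].
(* The list being folded is generalized to any list of positions from [upper n]. *)
elim: {1 3}(upper n) s => [|p ps IH] s sub /=; first exact: leads_to_refl.
have p_upper : p \in upper n by apply: sub; rewrite mem_head.

apply: (leads_to_trans (@normalize_at_sound s p p_upper)) => t.
by rewrite inE => /eqP->; apply: IH => q qps; apply: sub; rewrite inE qps orbT.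
Qed.

Lemma reps_sound : leads_to (generic n) (reps n).
Proof.
apply: (leads_to_trans (@leaves_sound (upper n) [::] (generic n))) => t tin.
apply: leads_to_sub (@normalize_sound t) => u; rewrite inE => /eqP->.
exact: (map_f (normalize n) tin).
Qed.

Lemma realizes_normal s N : normal n s -> realizes s N -> N = pattern s.
Proof.
move=> /eqP snorm sN; apply/matrixP => i j; rewrite mxE.
have := sN i j; rewrite snorm entry_tab //=.
by case: ifP => _ /eqP->.
Qed.

Lemma tconj_rep N : all (normal n) (reps n) ->
  (forall i j : 'I_n, (j <= i)%N -> N i j = 0) ->
  exists2 s, s \in reps n & tconj N (pattern s).
Proof.
move=> /allP norm N0.
have /reps_sound[s [N' [sin sN' NN']]] : realizes (generic n) N.
  move=> i j; rewrite entry_tab //=; case: ltnP => // ji.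
  by rewrite /= N0.
by exists s; rewrite // -(realizes_normal (norm s sin) sN').
Qed.

End Soundness.

(** * Separation of the representatives *)

(* The entries of A occurring, all with coefficient 1 or -1, in the (i, j)
   entry of r A - A s when A is upper triangular. *)
Definition conj_left n (r : state) (p : nat * nat) : seq (nat * nat) :=
  [seq (k, p.2) | k <- iota 0 n & (k <= p.2)%N && (cell_at r (p.1, k) == One)].

Definition conj_right n (s : state) (p : nat * nat) : seq (nat * nat) :=
  [seq (p.1, k) | k <- iota 0 n & (p.1 <= k)%N && (cell_at s (k, p.2) == One)].

(** Multiplicities are kept: an unknown occurring on both sides of an equation, where it may cancel,
    counts twice and so is not deduced to vanish. *)
Definition propagate (eqs : seq (seq (nat * nat))) (zs : seq (nat * nat)) :=
  foldl (fun zs e => if [seq p <- e | p \notin zs] is [:: p] then p :: zs else zs)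
    zs eqs.

Definition separated n (r s : state) : bool :=
  let eqs := [seq conj_left n r p ++ conj_right n s p | p <- upper n] in
  let zs := iter n (propagate eqs) [::] in
  has (fun i => (i, i) \in zs) (iota 0 n).

Section Separation.
Variables (F : fieldType) (n : nat) (A : 'M[F]_n).

(** Reads entries of [A] at pairs of naturals, with value 0 (an empty sum) outside the matrix, so
    that no bounds are carried along the symbolic lists. *)
Definition coord (p : nat * nat) : F :=
  \sum_(i < n | val i == p.1) \sum_(j < n | val j == p.2) A i j.

Lemma coordE (i j : 'I_n) : coord (val i, val j) = A i j.
Proof.
rewrite /coord (eq_bigl (pred1 i)) => [|k]; last by rewrite /= -[RHS]val_eqE.
by rewrite big_pred1_eq (big_pred1 j) // => k; rewrite /= -[RHS]val_eqE.
Qed.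

Lemma conj_left_sum r (i j : 'I_n) :
  (forall i j : 'I_n, (j < i)%N -> A i j = 0) ->
  \sum_(p <- conj_left n r (val i, val j)) coord p = (pattern F n r *m A) i j.
Proof.
move=> A0; rewrite mxE big_map big_filter big_mkcond /=.
rewrite -[n in iota 0 n]subn0 big_mkord; apply: eq_bigr => k _.
rewrite mxE coordE; case: eqP; rewrite ?andbF ?mul0r // mul1r andbT.
by case: leqP => // jk; rewrite A0.
Qed.

Lemma conj_right_sum s (i j : 'I_n) :
  (forall i j : 'I_n, (j < i)%N -> A i j = 0) ->
  \sum_(p <- conj_right n s (val i, val j)) coord p = (A *m pattern F n s) i j.
Proof.
move=> A0; rewrite mxE big_map big_filter big_mkcond /=.
rewrite -[n in iota 0 n]subn0 big_mkord; apply: eq_bigr => k _.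
rewrite mxE coordE; case: eqP; rewrite ?andbF ?mulr0 // mulr1 andbT.
by case: leqP => // ik; rewrite A0.
Qed.

Lemma sum_coord_unknown (zs ps : seq (nat * nat)) :
  {in zs, forall p, coord p = 0} ->
  \sum_(p <- ps) coord p = \sum_(p <- [seq p <- ps | p \notin zs]) coord p.
Proof.
move=> z0; rewrite big_filter [RHS]big_mkcond; apply: eq_bigr => p _.
by case: ifPn => // /negbNE/z0.
Qed.

(** Each [e] concatenates the two sides of an equation. Once the known zeros are removed, a lone
    survivor on one side faces an empty sum on the other. *)
Lemma propagate_sound eqs zs :
  {in eqs, forall e, exists ps qs,
    e = ps ++ qs /\ \sum_(p <- ps) coord p = \sum_(p <- qs) coord p} ->
  {in zs, forall p, coord p = 0} ->
  {in propagate eqs zs, forall p, coord p = 0}.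
Proof.
rewrite /propagate; elim: eqs zs => //= e eqs IH zs eqs0 z0.
apply: IH => [f feqs|]; first by apply: eqs0; rewrite inE feqs orbT.
have [ps [qs [-> ]]] := eqs0 e (mem_head _ _).
rewrite (sum_coord_unknown ps z0) (sum_coord_unknown qs z0) filter_cat.
case: [seq p <- ps | _] => [|p [|? ?]] /=; last by move=> _; apply: z0.
  case: [seq p <- qs | _] => [|q [|? ?]] //=; rewrite big_nil big_seq1 => q0.
  by move=> p; rewrite inE => /predU1P[->|/z0].
case: [seq p <- qs | _] => [|? ?] //=; rewrite big_nil big_seq1 => p0.
by move=> q; rewrite inE => /predU1P[->|/z0].
Qed.

End Separation.

Lemma separatedP (F : fieldType) n r s :
  separated n r s -> ~ tconj (pattern F n r) (pattern F n s).
Proof.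
move=> /hasP[i]; rewrite mem_iota /= => i_n izs [A tA rA].
have [A0 /(_ (Ordinal i_n))/negP[]] := invertible_triangularP _ tA.
rewrite -coordE /=; apply/eqP.
suff zsP m : {in iter m (propagate [seq conj_left n r p ++ conj_right n s p |
    p <- upper n]) [::], forall p, coord A p = 0} by apply: zsP izs.
elim: m => //= m IH; apply: propagate_sound => // e /mapP[[k l]].
move=> /mem_upper/= /andP[kl l_n] ->.
exists (conj_left n r (k, l)), (conj_right n s (k, l)); split=> //.
have := @conj_left_sum F n A r (Ordinal (ltn_trans kl l_n)) (Ordinal l_n) A0.
by rewrite rA -conj_right_sum.
Qed.

(** * Counting the triangular orbits *)

Definition classified n m : bool :=
  let rs := reps n in
  [&& size rs == m, all (normal n) rs & pairwise (separated n) rs].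

Section Cardinality.
Variables (F : fieldType) (n : nat).
Local Open Scope classical_set_scope.
Local Open Scope card_scope.

Lemma unitriangular_pattern s :
  normal n s -> unitriangular (1%:M + pattern F n s).
Proof.
move=> /eqP snorm; apply/unitriangularP => i j ji.
by rewrite !mxE snorm entry_tab //= ltnNge ji /= addr0.
Qed.

(* Junk value 1 when s is not normal. *)
Definition UT_pattern s : UT n F := insubd (UT_one n F) (1%:M + pattern F n s).

Lemma UT_patternE s : normal n s -> UT_val (UT_pattern s) - 1%:M = pattern F n s.
Proof.
move=> ns; rewrite [UT_val _]val_insubd unitriangular_pattern //.
by rewrite addrAC subrr add0r.
Qed.

Lemma T_orbit_rep (x : UT n F) : all (normal n) (reps n) ->
  exists2 s, s \in reps n & T_orbit x (UT_pattern s).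
Proof.
move=> nreps; have [i j ji | s sin xs] := @tconj_rep F n (UT_val x - 1%:M) nreps.
  by have /unitriangularP/(_ i j ji) := UT_valP x; rewrite !mxE => ->; rewrite subrr.
by exists s => //; apply/T_orbitP; rewrite UT_patternE // (allP nreps).
Qed.

Lemma T_orbits_card m : classified n m -> T_orbits n F #= `I_m.
Proof.
case/and3P=> /eqP<- nreps sep; have nP := allP nreps.
have -> : T_orbits n F =
    (fun i => T_orbit (UT_pattern (nth [::] (reps n) i))) @` `I_(size (reps n)).
  apply/seteqP; split=> _ [x _ <-]; last by exists (UT_pattern (nth [::] (reps n) x)).
  have [s sin xs] := T_orbit_rep x nreps.
  exists (index s (reps n)); first by rewrite /= index_mem.
  by rewrite nth_index //; apply/esym/eq_T_orbit/T_orbitP.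
(* Injectivity of the indexing: [pairwise] separates only indices in increasing order, and symmetry
   of [tconj] handles the other order. *)
apply: inj_card_eq => i j; rewrite !inE /= => i_n j_n.
move/eq_T_orbit; rewrite !UT_patternE ?nP ?mem_nth // => ij.
have /(pairwiseP [::]) sepP := sep.
case: (ltngtP i j) => // [ij' | ji].
  by case: (separatedP (sepP i j i_n j_n ij') ij).
by case: (separatedP (sepP j i j_n i_n ji) (tconj_sym ij)).
Qed.

End Cardinality.

(** States do not mention the field, so this one computation serves every [F]. *)
Lemma classified_reps :
  [&& classified 0 1, classified 1 1, classified 2 2, classified 3 5,
      classified 4 16 & classified 5 61]%N.
Proof. by vm_compute. Qed.

(** * Automorphism orbits *)

Section AutomorphismOrbits.
Variable G : groupType.
Implicit Types (f : G -> G) (g h : G).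
Local Open Scope group_scope.

Lemma mem_aut_orbit f g :
  {morph f : x y / x * y} -> bijective f -> aut_orbit g (f g).
Proof.
move=> fM fb; pose F : {multiplicative G -> G} :=
  HB.pack f (isMultiplicative.Build G G f fM).
by exists F.
Qed.

Lemma aut_orbit_refl g : aut_orbit g g.
Proof. by apply: (@mem_aut_orbit id) => //; exists id. Qed.

Lemma eq_aut_orbit g h : aut_orbit g h -> aut_orbit g = aut_orbit h.
Proof.
case=> f fb <-; have [f' fK f'K] := fb.
have f'M : {morph f' : x y / x * y}.
  by move=> x y; apply: (bij_inj fb); rewrite gmulfM !f'K.
apply/seteqP; split=> _ [e eb <-].
  have -> : e g = (e \o f') (f g) by rewrite /= fK.
  apply: (@mem_aut_orbit (e \o f')) => [x y /=|].
    by rewrite f'M gmulfM.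
  by apply: bij_comp => //; exists f.
apply: (@mem_aut_orbit (e \o f)) => [x y /=|]; first by rewrite !gmulfM.
exact: bij_comp.
Qed.

Lemma aut_orbit1 h : aut_orbit 1 h -> h = 1.
Proof.
case=> f _ <-; apply: (@mulgI _ (f 1)).
by rewrite -gmulfM !mulg1.
Qed.

(** Together with the triviality of the orbit of 1, this invariant tells apart the three orbits of
    [UT 3 F]. *)
Lemma aut_orbit_central g h :
  aut_orbit g h -> (forall x, g * x = x * g) -> forall x, h * x = x * h.
Proof.
case=> f [f' _ f'K] <- gC x.
by rewrite -(f'K x) -!gmulfM gC.
Qed.

End AutomorphismOrbits.

Section FiniteAutomorphismOrbits.
Variables (F : fieldType) (n : nat).
Local Open Scope classical_set_scope.
Local Open Scope card_scope.

Lemma unitriangular_conj (A N : 'M[F]_n) :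
  invertible_triangular A -> unitriangular N ->
  unitriangular (invmx A *m N *m A).
Proof.
move=> tA /unitriangularP N1; have /andP[_ uA] := tA.
have [A0 _] := invertible_triangularP _ tA.
have [B0 _] := invertible_triangularP _ (invertible_triangularV tA).
(* In the second summand a strictly upper triangular matrix stands between two upper triangular
   ones, so it vanishes on and below the diagonal. *)
have -> : invmx A *m N *m A = 1%:M + invmx A *m (N - 1%:M) *m A.
  by rewrite mulmxBr mulmxBl mulmx1 mulVmx // addrC subrK.
apply/unitriangularP => i j ji; rewrite !mxE big1 ?addr0 // => b _.
have [bj | jb] := leqP b j; last by rewrite A0 ?mulr0.
rewrite mxE big1 ?mul0r // => a _.
have [ai | ia] := ltnP a i; first by rewrite B0 ?mul0r.
rewrite !mxE N1 ?subrr ?mulr0 //.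
exact: leq_trans bj (leq_trans ji ia).
Qed.

Lemma T_orbit_sub_aut_orbit (x : UT n F) : T_orbit x `<=` aut_orbit x.
Proof.
move=> y [A tA yA]; have /andP[_ uA] := tA.
have tV := invertible_triangularV tA.
pose f (z : UT n F) : UT n F := MkUT (unitriangular_conj tA (UT_valP z)).
pose f' (z : UT n F) : UT n F := MkUT (unitriangular_conj tV (UT_valP z)).
have -> : y = f x by apply: val_inj; rewrite /= -yA.
apply: mem_aut_orbit => [z t|].
  by apply: val_inj; rewrite /= !mulmxA mulmxK.
exists f' => z; apply: val_inj; rewrite /= invmxK.
  by rewrite !mulmxA mulmxV // mul1mx mulmxK.
by rewrite !mulmxA mulVmx // mul1mx mulmxKV.
Qed.

(** Several representatives may share an automorphism orbit, so this bounds the number of orbits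
    without counting them. *)
Lemma aut_orbits_reps : all (normal n) (reps n) ->
  aut_orbits (UT n F) =
  (fun s => aut_orbit (UT_pattern F n s)) @` [set` reps n].
Proof.
move=> nreps; apply/seteqP; split=> _ [x xin <-]; last by exists (UT_pattern F n x).
have [s sin /T_orbit_sub_aut_orbit xs] := T_orbit_rep x nreps.
by exists s; rewrite // (eq_aut_orbit xs).
Qed.

Lemma finite_aut_orbits m :
  classified n m -> finite_set (aut_orbits (UT n F)).
Proof.
by case/and3P=> _ /aut_orbits_reps-> _; apply: finite_image; apply: finite_seq.
Qed.

End FiniteAutomorphismOrbits.

(** * Automorphism orbits of the Heisenberg group *)

Section Heisenberg.
Variable F : fieldType.
Implicit Types (a b c : F) (x y : UT 3 F).
Local Open Scope classical_set_scope.
Local Open Scope card_scope.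

Definition heis_mx a b c : 'M[F]_3 :=
  \matrix_(i, j) match val i, val j with
                 | 0%N, 1%N => a | 1%N, 2%N => b | 0%N, 2%N => c
                 | k, l => (k == l)%:R
                 end.

Lemma unitriangular_heis_mx a b c : unitriangular (heis_mx a b c).
Proof.
by apply/unitriangularP => -[[|[|[|i]]] ?] [[|[|[|j]]] ?]; rewrite // mxE.
Qed.

Definition heis a b c : UT 3 F := MkUT (unitriangular_heis_mx a b c).

Local Notation o0 := (@Ordinal 3 0 isT).
Local Notation o1 := (@Ordinal 3 1 isT).
Local Notation o2 := (@Ordinal 3 2 isT).

Definition c01 x := UT_val x o0 o1.
Definition c12 x := UT_val x o1 o2.
Definition c02 x := UT_val x o0 o2.

Lemma heisE x : x = heis (c01 x) (c12 x) (c02 x).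
Proof.
apply: val_inj; apply/matrixP => i j; rewrite mxE.
have xP := unitriangularP _ (UT_valP x).
by case: i j => [[|[|[|i]]] i3] [[|[|[|j]]] j3] //=;
  solve [by rewrite xP | by congr (UT_val x _ _); apply: val_inj].
Qed.

Lemma c01_heis a b c : c01 (heis a b c) = a. Proof. by rewrite /c01 mxE. Qed.
Lemma c12_heis a b c : c12 (heis a b c) = b. Proof. by rewrite /c12 mxE. Qed.
Lemma c02_heis a b c : c02 (heis a b c) = c. Proof. by rewrite /c02 mxE. Qed.
Definition coord_heis := (c01_heis, c12_heis, c02_heis).

Lemma heisM a b c a' b' c' :
  (heis a b c * heis a' b' c')%g = heis (a + a') (b + b') (c + c' + a * b').
Proof.
rewrite [LHS]heisE /c01 /c12 /c02 /= !mxE !big_ord_recl !big_ord0 !mxE /=.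
by congr heis; ring.
Qed.

(** Reflection in the antidiagonal and inversion both reverse products; their composite, followed by
    conjugation by diag(1, -1, 1), is this automorphism. *)
Lemma heis_flip a b c : aut_orbit (heis a b c) (heis b a (a * b - c)).
Proof.
pose f x := heis (c12 x) (c01 x) (c01 x * c12 x - c02 x).
have -> : heis b a (a * b - c) = f (heis a b c) by rewrite /f !coord_heis.
apply: mem_aut_orbit => [x y|].
  rewrite (heisE x) (heisE y) heisM /f !coord_heis heisM.
  by congr heis; ring.
have fK : cancel f f.
  by move=> x; rewrite [RHS]heisE /f !coord_heis; congr heis; ring.
by exists f.
Qed.

(* Up to heis_flip, these automorphisms carry (1, 0, 0) to every noncentral
   element, by the choice of r, t and l. *)
Lemma heis_shear a b c r t l : 2%N \notin [pchar F] -> r != 0 ->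
  aut_orbit (heis a b c)
    (heis (r * a) (b + t * a) (r * c + r * t * a ^+ 2 / 2 + l * a)).
Proof.
rewrite inE /= => char2 r0.
(* Adding t a to the second coordinate creates the cross term r t a a' in the corner of a product;
   the quadratic term r t a^2 / 2 compensates for it, whence the exclusion of characteristic 2. *)
pose f x := heis (r * c01 x) (c12 x + t * c01 x)
  (r * c02 x + r * t * c01 x ^+ 2 / 2 + l * c01 x).
pose f' x := heis (c01 x / r) (c12 x - t * (c01 x / r))
  ((c02 x - r * t * (c01 x / r) ^+ 2 / 2 - l * (c01 x / r)) / r).
have -> : heis (r * a) (b + t * a) (r * c + r * t * a ^+ 2 / 2 + l * a) =
    f (heis a b c) by rewrite /f !coord_heis.
apply: mem_aut_orbit => [x y|].
  rewrite (heisE x) (heisE y) heisM /f !coord_heis heisM.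
  by congr heis; field.
by exists f' => x; rewrite [RHS]heisE /f /f' !coord_heis; congr heis; field;
  rewrite ?r0.
Qed.

Lemma aut_orbit_heis100 a b c : 2%N \notin [pchar F] -> a != 0 ->
  aut_orbit (heis 1 0 0) (heis a b c).
Proof.
(* Here r = a and t = b, while [l] corrects the corner a b / 2 to [c]. *)
move=> char2 a0; have := heis_shear 1 0 0 b (c - a * b / 2) char2 a0.
by rewrite !mulr1 mulr0 !add0r expr1n mulr1 addrC subrK.
Qed.

Lemma aut_orbits_UT3 : 2%N \notin [pchar F] -> aut_orbits (UT 3 F) #= `I_3.
Proof.
(* The default of [nth] is the third representative: [r 2] is [heis 1 0 0]. *)
move=> char2; pose r := nth (heis 1 0 0) [:: 1%g; heis 0 0 1].
have heis0 : 1%g = heis 0 0 0 by rewrite [LHS]heisE /c01 /c12 /c02 !mxE.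
have -> : aut_orbits (UT 3 F) = (fun i => aut_orbit (r i)) @` `I_3.
  apply/seteqP; split=> _ [x + <-]; last by exists (r x).
  rewrite (heisE x) => _; move: (c01 x) (c12 x) (c02 x) => a b c.
  have [-> | a0] := eqVneq a 0; last first.
    by exists 2%N => //; apply/eq_aut_orbit/aut_orbit_heis100.
  have [-> | b0] := eqVneq b 0; last first.
    have flip : aut_orbit (heis b 0 (- c)) (heis 0 b c).
      by have := heis_flip b 0 (- c); rewrite mulr0 sub0r opprK.
    exists 2%N => //; rewrite -(eq_aut_orbit flip).
    exact/eq_aut_orbit/aut_orbit_heis100.
  have [-> | c0] := eqVneq c 0; first by exists 0%N; rewrite // /r /= heis0.
  exists 1%N => //; apply: eq_aut_orbit.
  (* Scaling by r = c carries the corner 1 to [c]. *)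
  have := heis_shear 0 0 1 0 0 char2 c0.
  by rewrite !(mulr0, addr0, mul0r, mulr1).
have rC i : (i < 2)%N -> forall x, (r i * x = x * r i)%g.
  case: i => [_ x|[_ x|//]]; first by rewrite /r /= mul1g mulg1.
  rewrite /r /= (heisE x) !heisM; congr heis; ring.
have r_sep i j : (i < j < 3)%N -> ~ aut_orbit (r i) (r j).
  (* For j = 2, [r i] is central whereas [heis 1 0 0] does not commute with [heis 0 1 0]. Otherwise
     i = 0 and j = 1, and the orbit of 1 is trivial. *)
  case/andP=> ij; rewrite ltnS leq_eqVlt => /predU1P[j2 | j2].
    subst j; move=> /aut_orbit_central/(_ (rC _ ij))/(_ (heis 0 1 0)).
    rewrite /r /= !heisM => /(congr1 c02)/eqP; rewrite !coord_heis.
    by rewrite !(add0r, mul0r, mulr1) oner_eq0.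
  case: i j ij j2 => [|i] [|[|j]] // _ _ /aut_orbit1.
  rewrite /r /= heis0 => /(congr1 c02)/eqP.
  by rewrite !coord_heis oner_eq0.
apply: inj_card_eq => i j; rewrite !inE /= => i3 j3 rij.
case: (ltngtP i j) => // [ij | ji].
  by case: (r_sep i j); [rewrite ij | rewrite rij; apply: aut_orbit_refl].
by case: (r_sep j i); [rewrite ji | rewrite -rij; apply: aut_orbit_refl].
Qed.

End Heisenberg.

Local Open Scope classical_set_scope.
Local Open Scope card_scope.

Theorem theorem1p1 (F : fieldType) (F_inf : infinite_set [set: F]) :
  [/\ forall n : nat, (n <= 5)%N -> finite_set (aut_orbits (UT n F)),
      2%N \notin [pchar F] -> aut_orbits (UT 3 F) #= `I_3,
      T_orbits 4 F #= `I_16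
    & T_orbits 5 F #= `I_61].
Proof.
have /and5P[c0 c1 c2 c3 /andP[c4 c5]] := classified_reps.
split.
- case=> [|[|[|[|[|[|//]]]]]] _.
  + exact: finite_aut_orbits c0.
  + exact: finite_aut_orbits c1.
  + exact: finite_aut_orbits c2.
  + exact: finite_aut_orbits c3.
  + exact: finite_aut_orbits c4.
  + exact: finite_aut_orbits c5.
- exact: aut_orbits_UT3.
- exact: T_orbits_card c4.
- exact: T_orbits_card c5.
Qed.
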